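(* Let $f$ be a Boolean function. There is a canonical partition of the complete set of primes of $f$ into disjoint sets \[(\text{Essential Primes})\cup PS_1\cup\dots\cup PS_N\cup(\text{Unnecessary Primes})\] such that: (1) the Essential Primes must be part of any basis for $f$; (2) $PS_1,\dots,PS_N$ are the primesets of the Independent Ancestor Sets $A_1,\dots,A_N$ for $f$; (3) the Independent Ancestor Sets $A_1,\dots,A_N$ are pairwise disjoint; (4) the Unnecessary Primes consist of the union of the free non-Essential primes with $Surplus$, and an Unnecessary Prime cannot be part of a minimum-cost basis for $f$ for any positive additive cost function; (5) for each $PS_i$ there is a canonical triples table $TS_i$ that contains all covering relationships between the products belonging to $A_i$; (6) given a positive additive cost function $C$, any minimum-cost basis for $f$ with respect to $C$ consists of the union of the Essential Primes with subsets $QS_i(C)\subseteq PS_i$ such that $QS_i(C)$ is a minimum-cost cover of $PS_i$ (that is, a minimum-cost subset for which $\mathrm{Cascade}(QS_i(C),TS_i)$ is empty).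
   Context: Products are conjunctions of literals; primes are minimal implicants of $f$; a basis is a set of primes whose OR equals $f$; a cost function assigns positive costs to products, additively over sets. Consensus $(U\circ V)$ of products with exactly one reversal variable is the product of their other literals; $\mathrm{Consensus}(S)$ is the closure of $S$ under valid consensus; a product is covered by $S$ if it lies in $\mathrm{Consensus}(S)$. Essential primes are primes not covered by the other primes; $\langle Free\rangle=\mathrm{Consensus}(\text{Essentials})$ (free products); products of $\mathrm{Consensus}(\text{all primes})$ not in $\langle Free\rangle$ are non-free, indexed $X_1,X_2,\dots$; non-free primes are primes not in $\langle Free\rangle$. The table $triples(f)$ consists of index triples $(r,i,j)$, $j\ge0$ (if $X_i$ and, when $j>0$, $X_j$ are covered then $X_r$ is covered; index 0 = free product): $(r,i,j)$ for each consensus $X_r=(X_i\circ X_j)$ of non-free products with $X_r$ non-free, $(r,i,0)$ for each consensus of non-free $X_i$ with a free product giving non-free $X_r$, and $(r,k,0)$ for non-free $X_r\in\mathrm{Consensus}(\langle Free\rangle\cup\{X_k\})$ for certain non-free primes $X_k$; useless entries ($(r,i,j)$, $j>0$, when $(r,i,0)$ or $(r,j,0)$ is present) and, repeatedly, entries whose first index never appears in a second/third position are removed. $\mathrm{Cascade}(S,T)$: start with list $L=S$; delete entries of $T$ with first index in $L$; replace indices of $L$ in second/third positions by $0$; append $t$ to $L$ for each entry becoming $(t,0,0)$; iterate until no change; the result is the remaining table (and $L$ is the cascade list). Parents: for $(r,i,0)$, $i$; for $(r,i,j)$, $j>0$, $i,j$. $Anc(r)$: parents, parents of parents, etc.; Ancestor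 Sets are sets $Anc(r)$; Independent ones do not properly contain another Ancestor Set; the primeset of $A$ is the set of primes in $A$; $triples(A)$ = entries $(r,i,j)$ of the current table with $r,i\in A$ and ($j=0$ or $j\in A$). The Independent Ancestor Sets $A_1,\dots,A_N$ for $f$: starting from $T=triples(f)$, repeatedly (1) remove useless entries and inactive indices, (2) find all Independent Ancestor Sets of $T$, (3) for each such $A$ set aside $TS=triples(A)$ and remove these entries from $T$, (4) cascade the union of these sets through $T$ removing covered indices, until $T$ is empty; $A_1,\dots,A_N$ are all sets found, $PS_i$ the primeset of $A_i$ and $TS_i=triples(A_i)$. $Surplus$ is the set of non-free primes not in $\bigcup_i PS_i$. *)

(* Defs.v *)
From HB Require Import structures.
From mathcomp Require Import all_boot all_order all_algebra.

Set Implicit Arguments.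
Unset Strict Implicit.
Unset Printing Implicit Defensive.

Import Order.TTheory GRing.Theory Num.Theory.

Local Open Scope ring_scope.

Notation point n := {ffun 'I_n -> bool}.
Notation boolfun n := {ffun {ffun 'I_n -> bool} -> bool}.

(* [p i] is [Some true] / [Some false] / [None] according as the literal x_i,
   the literal x_i', or neither occurs in p; the product without literals is
   the constant 1. *)
Notation product n := {ffun 'I_n -> option bool}.

Definition eval n (p : product n) (x : point n) : bool :=
  [forall i, if p i is Some b then x i == b else true].

Definition implicant n (f : boolfun n) (p : product n) : bool :=
  [forall x, eval p x ==> f x].

(* every literal of q is a literal of p *)
Definition subproduct n (q p : product n) : bool :=
  [forall i, (q i == None) || (q i == p i)].

Definition prime_of n (f : boolfun n) (p : product n) : bool :=
  implicant f p &&
  [forall q : product n, implicant f q && subproduct q p ==> (q == p)].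

Definition prime_products n (f : boolfun n) : {set product n} :=
  [set p | prime_of f p].

Definition is_basis n (f : boolfun n) (B : {set product n}) : Prop :=
  B \subset prime_products f /\
  forall x : point n, f x = [exists p in B, eval p x].

Definition reversals n (p q : product n) : {set 'I_n} :=
  [set i | [exists b, (p i == Some b) && (q i == Some (~~ b))]].

Definition valid_consensus n (p q : product n) : bool :=
  #|reversals p q| == 1%N.

Definition consensus n (p q : product n) : product n :=
  [ffun i => if i \in reversals p q then None
             else if p i is Some b then Some b else q i].

Definition consensus_closed n (D : {set product n}) : bool :=
  [forall p in D, forall q in D,
     valid_consensus p q ==> (consensus p q \in D)].

Definition Consensus n (S : {set product n}) : {set product n} :=
  \bigcap_(D : {set product n} | (S \subset D) && consensus_closed D) D.

Definition essentials n (f : boolfun n) : {set product n} :=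
  [set p in prime_products f | p \notin Consensus (prime_products f :\ p)].

Definition free_products n (f : boolfun n) : {set product n} :=
  Consensus (essentials f).

Definition nonfree_products n (f : boolfun n) : {set product n} :=
  Consensus (prime_products f) :\: free_products f.

Definition nonfree_primes n (f : boolfun n) : {set product n} :=
  prime_products f :\: free_products f.

(* The non-free products serve as their own indices, so that nothing depends on
   the choice of an enumeration X_1, X_2, ...; the index 0 is [None].  The
   positions of the second and third indices are immaterial: all notions below
   treat (r, i, j) and (r, j, i) alike, in particular (r, 0, j) and (r, j, 0). *)
Notation entry n := (product n * option (product n) * option (product n))%type.

Definition first n (e : entry n) : product n := e.1.1.

Definition parents n (e : entry n) : {set product n} :=
  [set i | (e.1.2 == Some i) || (e.2 == Some i)].

(* Finite iteration "until no change": if the sequence x, g x, g (g x), ... is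
   eventually constant, its values are pairwise distinct until then, hence it
   has reached its limit after #|T| steps. *)
Definition stabilize (T : finType) (g : T -> T) (x : T) : T := iter #|T| g x.

Definition remove_useless n (T : {set entry n}) : {set entry n} :=
  [set e in T |
     ~~ ((#|parents e| == 2%N) &&
         [exists e' in T, [&& first e' == first e, #|parents e'| == 1%N
                            & parents e' \subset parents e]])].

Definition remove_inactive n (T : {set entry n}) : {set entry n} :=
  [set e in T | [exists e' in T, first e \in parents e']].

Definition reduce n (T : {set entry n}) : {set entry n} :=
  stabilize (@remove_inactive n) (remove_useless T).

(* K is the set of the non-free primes X_k for which the products of
   Consensus(<Free> u {X_k}) are recorded. *)
Definition raw_triples n (f : boolfun n) (K : {set product n}) :
    {set entry n} :=
  [set e : entry n | (first e \in nonfree_products f) &&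
     match e with
     | (r, Some i, Some j) =>
         [&& i \in nonfree_products f, j \in nonfree_products f,
             valid_consensus i j & r == consensus i j]
     | (r, Some i, None) =>
         ((i \in nonfree_products f) &&
          [exists p in free_products f,
             valid_consensus i p && (r == consensus i p)])
         || [&& i \in K, r != i & r \in Consensus (i |: free_products f)]
     | _ => false
     end].

Definition triples n (f : boolfun n) (K : {set product n}) : {set entry n} :=
  reduce (raw_triples f K).

Definition zero_index n (L : {set product n}) (i : option (product n)) :
    option (product n) :=
  if i is Some p then if p \in L then None else Some p else None.

Definition zero_entry n (L : {set product n}) (e : entry n) : entry n :=
  (e.1.1, zero_index L e.1.2, zero_index L e.2).

Definition cascade_step n (s : {set product n} * {set entry n}) :
    {set product n} * {set entry n} :=
  let L := s.1 in
  let T := [set zero_entry L e | e in [set e in s.2 | first e \notin L]] in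
  (L :|: [set t | (t, None, None) \in T], T).

Definition cascade_list n (S : {set product n}) (T : {set entry n}) :
    {set product n} :=
  (stabilize (@cascade_step n) (S, T)).1.

Definition Cascade n (S : {set product n}) (T : {set entry n}) :
    {set entry n} :=
  (stabilize (@cascade_step n) (S, T)).2.

Definition parent_rel n (T : {set entry n}) : rel (product n) :=
  fun r i => [exists e in T, (first e == r) && (i \in parents e)].

(* r itself belongs to Anc(r) only if it is one of its own ancestors *)
Definition Anc n (T : {set entry n}) (r : product n) : {set product n} :=
  [set a | [exists i, parent_rel T r i && connect (parent_rel T) i a]].

Definition ancestor_sets n (T : {set entry n}) : {set {set product n}} :=
  [set Anc T (first e) | e in T].

Definition independent_sets n (T : {set entry n}) : {set {set product n}} :=
  [set A in ancestor_sets T | ~~ [exists B in ancestor_sets T, B \proper A]].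

Definition primeset n (f : boolfun n) (A : {set product n}) :
    {set product n} :=
  A :&: prime_products f.

Definition triples_of n (T : {set entry n}) (A : {set product n}) :
    {set entry n} :=
  [set e in T | (first e \in A) && (parents e \subset A)].

(* One round on a pair (current table, list of the pairs (A, triples(A)) found
   so far). *)
Definition extraction_round n
    (s : {set entry n} * seq ({set product n} * {set entry n})) :
    {set entry n} * seq ({set product n} * {set entry n}) :=
  let T := reduce s.1 in
  let found := independent_sets T in
  let T' := T :\: \bigcup_(A in found) triples_of T A in
  (Cascade (\bigcup_(A in found) A) T',
   s.2 ++ [seq (A, triples_of T A) | A <- enum found]).

(* As long as the table is non-empty, a round strictly decreases its number of
   entries; on the empty table a round does nothing.  So #|T| rounds suffice. *)
Definition extraction n (f : boolfun n) (K : {set product n}) :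
    {set entry n} * seq ({set product n} * {set entry n}) :=
  let T := triples f K in iter #|T| (@extraction_round n) (T, [::]).

(* [:: (A_1, TS_1); ...; (A_N, TS_N)] *)
Definition IAS n (f : boolfun n) (K : {set product n}) :
    seq ({set product n} * {set entry n}) :=
  (extraction f K).2.

Definition cost (R : realFieldType) n (c : product n -> R)
    (S : {set product n}) : R :=
  \sum_(p in S) c p.

Definition min_cost_basis (R : realFieldType) n (c : product n -> R)
    (f : boolfun n) (B : {set product n}) : Prop :=
  is_basis f B /\ forall B', is_basis f B' -> cost c B <= cost c B'.

Definition is_cover n (PS : {set product n}) (TS : {set entry n})
    (Q : {set product n}) : Prop :=
  Q \subset PS /\ Cascade Q TS = set0.

Definition min_cost_cover (R : realFieldType) n (c : product n -> R)
    (PS : {set product n}) (TS : {set entry n}) (Q : {set product n}) : Prop :=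
  is_cover PS TS Q /\ forall Q', is_cover PS TS Q' -> cost c Q <= cost c Q'.

(* Main.v *)
Require Import Defs.
From HB Require Import structures.
From mathcomp Require Import all_boot all_order all_algebra.

Set Implicit Arguments.
Unset Strict Implicit.
Unset Printing Implicit Defensive.

Import Order.TTheory GRing.Theory Num.Theory.

Local Open Scope ring_scope.

(* Restricted to the non-free products, Consensus is the closure under the rules
   "if the parents of an entry are covered, so is its first index", and
   completeness of consensus makes the bases exactly the sets of primes with
   full closure.  At each round, an Independent Ancestor Set is closed under
   parents, so nothing outside it helps to cover it: every basis contains a
   cover of each PS_i.  Conversely, a product dropped as inactive was not used
   to cover anything else, hence it is covered once all A_i are; so the essential
   primes and arbitrary covers of the PS_i together form a basis.  Trimming a
   minimum-cost basis to its essential primes and its intersections with the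
   PS_i therefore loses nothing, and each intersection can be exchanged for any
   other cover. *)

(** * Consensus *)

Lemma reversalsP n (p q : product n) (i : 'I_n) :
  reflect (exists b, p i = Some b /\ q i = Some (~~ b)) (i \in reversals p q).
Proof.
rewrite inE; apply: (iffP existsP) => -[b].
  by case/andP=> /eqP -> /eqP ->; exists b.
by case=> -> ->; exists b; rewrite !eqxx.
Qed.

Lemma reversalsC n (p q : product n) : reversals p q = reversals q p.
Proof.
suff sub (u v : product n) : reversals u v \subset reversals v u.
  by apply/eqP; rewrite eqEsubset !sub.
apply/subsetP=> i /reversalsP [b [ui vi]]; apply/reversalsP.
by exists (~~ b); rewrite negbK.
Qed.

Lemma consensusC n (p q : product n) : consensus p q = consensus q p.
Proof.
apply/ffunP=> i; rewrite !ffunE [in RHS]reversalsC.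
case: ifP => // /reversalsP irev.
case pi: (p i) => [a|]; case qi: (q i) => [b|] //; congr Some.
by apply/eqP/negPn/negP=> /negP; case: a b pi qi => [] [] // pi qi _;
  case: irev; [exists true | exists false].
Qed.

Lemma valid_consensusC n (p q : product n) :
  valid_consensus p q = valid_consensus q p.
Proof. by rewrite /valid_consensus reversalsC. Qed.

Lemma consensus_closedP n (D : {set product n}) :
  reflect (forall p q, p \in D -> q \in D -> valid_consensus p q ->
             consensus p q \in D)
          (consensus_closed D).
Proof.
apply: (iffP forall_inP) => [DP p q pD qD pq | DP p pD].
  by have /forall_inP/(_ q qD)/implyP := DP p pD; apply.
by apply/forall_inP=> q qD; apply/implyP; apply: DP.
Qed.

Lemma sub_Consensus n (S : {set product n}) : S \subset Consensus S.
Proof. by apply/bigcapsP=> D /andP []. Qed.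

Lemma Consensus_min n (S D : {set product n}) :
  S \subset D -> consensus_closed D -> Consensus S \subset D.
Proof. by move=> SD clD; apply: bigcap_inf; rewrite SD. Qed.

Lemma Consensus_closed n (S : {set product n}) :
  consensus_closed (Consensus S).
Proof.
apply/consensus_closedP=> p q /bigcapP pS /bigcapP qS pq.
apply/bigcapP=> D DP; have /andP [_ /consensus_closedP clD] := DP.
by apply: clD => //; [apply: pS | apply: qS].
Qed.

Lemma ConsensusS n (S S' : {set product n}) :
  S \subset S' -> Consensus S \subset Consensus S'.
Proof.
move=> SS'; apply: Consensus_min; last exact: Consensus_closed.
exact: subset_trans SS' (sub_Consensus S').
Qed.

Lemma Consensus_sub n (S S' : {set product n}) :
  S \subset Consensus S' -> Consensus S \subset Consensus S'.
Proof. by move=> SS'; apply: Consensus_min => //; apply: Consensus_closed. Qed.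

(** Inversion: [S] together with the single consensuses of members of [Consensus S] is already
    closed, so it contains the whole closure. *)
Lemma ConsensusP n (S : {set product n}) (r : product n) :
  r \in Consensus S -> r \in S \/
  exists p q, [/\ p \in Consensus S, q \in Consensus S, valid_consensus p q
                & r = consensus p q].
Proof.
pose D := S :|: [set r | [exists p in Consensus S, exists q in Consensus S,
                           valid_consensus p q && (r == consensus p q)]].
have DS : D \subset Consensus S.
  rewrite subUset sub_Consensus; apply/subsetP=> x; rewrite inE.
  case/exists_inP=> p pS /exists_inP [q qS /andP [pq /eqP ->]].
  by have /consensus_closedP := Consensus_closed S; apply.
suff SD : Consensus S \subset D.
  move/(subsetP SD); rewrite !inE => /orP [->|]; first by left.
  case/exists_inP=> p pS /exists_inP [q qS /andP [pq /eqP ->]].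
  by right; exists p, q.
apply: Consensus_min; first exact: subsetUl.
apply/consensus_closedP=> p q pD qD pq; rewrite 2!inE; apply/orP; right.
apply/exists_inP; exists p; first exact: (subsetP DS).
apply/exists_inP; exists q; first exact: (subsetP DS).
by rewrite pq eqxx.
Qed.

(** * Evaluation at points and completeness of consensus *)

Lemma evalP n (p : product n) (x : point n) :
  reflect (forall i b, p i = Some b -> x i = b) (eval p x).
Proof.
apply: (iffP forallP) => [px i b pi | px i].
  by have := px i; rewrite pi => /eqP.
by case pi: (p i) => [b|] //; rewrite (px _ _ pi).
Qed.

Lemma subproductP n (q p : product n) :
  reflect (forall i b, q i = Some b -> p i = Some b) (subproduct q p).
Proof.
apply: (iffP forallP) => [qp i b qi | qp i].
  by have := qp i; rewrite qi /= => /eqP.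
by case qi: (q i) => [b|] //=; rewrite (qp _ _ qi).
Qed.

(** The value of [x] at the unique reversal variable decides between [p] and [q]; their other
    literals all occur in the consensus. *)
Lemma eval_consensus n (p q : product n) (x : point n) :
  valid_consensus p q -> eval (consensus p q) x -> eval p x \/ eval q x.
Proof.
case/cards1P=> i revE /evalP cx.
have /reversalsP [b [pi qi]] : i \in reversals p q by rewrite revE set11.
have cE j : j != i -> consensus p q j = if p j is Some b then Some b else q j.
  by move=> ji; rewrite ffunE revE inE (negPf ji).
have cE' j : j != i -> consensus p q j = if q j is Some b then Some b else p j.
  by move=> ji; rewrite consensusC ffunE reversalsC revE inE (negPf ji).
case: (eqVneq (x i) b) => xi; [left | right]; apply/evalP=> j a ja.
  case: (eqVneq j i) => [ji|ji]; last by apply: cx; rewrite cE // ja.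
  by move: ja; rewrite ji pi xi => -[].
case: (eqVneq j i) => [ji|ji]; last by apply: cx; rewrite cE' // ja.
by move: ja xi; rewrite ji qi => -[<-]; case: (b) (x i) => [] [].
Qed.

(** Soundness: the products that imply the OR of [S] at [x] form a set closed under consensus. *)
Lemma eval_Consensus n (S : {set product n}) p x :
  p \in Consensus S -> eval p x -> [exists q in S, eval q x].
Proof.
pose D := [set p : product n | eval p x ==> [exists q in S, eval q x]].
have /subsetP sub : Consensus S \subset D.
  apply: Consensus_min.
    apply/subsetP=> q qS; rewrite inE; apply/implyP=> qx.
    by apply/exists_inP; exists q.
  apply/consensus_closedP=> u v; rewrite !inE => /implyP uD /implyP vD uv.
  by apply/implyP=> /(eval_consensus uv) [].
by move/sub; rewrite inE => /implyP.
Qed.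

(* Completeness of consensus: split p along a variable it does not mention. *)
Lemma consensus_complete n (D : {set product n}) (p : product n) :
  consensus_closed D -> (forall x, eval p x -> [exists q in D, eval q x]) ->
  exists2 q, q \in D & subproduct q p.
Proof.
move=> /consensus_closedP clD.
have [m] := ubnP #|[set i | p i == None]|.
elim: m p => // m IHm p; rewrite ltnS => pm pD.
case: (pickP [pred i | p i == None]) => [i /= /eqP pi | pfull]; last first.
  (* Here [p] mentions every variable, so it holds at [x] only and the default [false] is never
     taken. *)
  pose x : point n := [ffun i => odflt false (p i)].
  have pE i : p i = Some (x i).
    by have /= := pfull i; rewrite ffunE; case: (p i).
  have /exists_inP [q qD /evalP qx] : [exists q in D, eval q x].
    by apply: pD; apply/evalP=> i b; rewrite pE => -[].
  by exists q => //; apply/subproductP=> i b qi; rewrite pE (qx _ _ qi).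
pose pb b : product n := [ffun j => if j == i then Some b else p j].
have IH b : exists2 q, q \in D & subproduct q (pb b).
  apply: IHm.
    apply: leq_trans pm; apply: proper_card; apply/properP; split.
      by apply/subsetP=> j; rewrite !inE ffunE; case: (j =P i).
    by exists i; rewrite !inE ?pi // ffunE eqxx.
  move=> x /evalP px; apply: pD; apply/evalP=> j a pj; apply: px.
  by rewrite ffunE; case: (j =P i) => // ji; rewrite ji pi in pj.
have [q0 q0D /subproductP q0p] := IH false.
have [q1 q1D /subproductP q1p] := IH true.
have lift b (q : product n) : (forall j a, q j = Some a -> pb b j = Some a) ->
    forall j a, j != i -> q j = Some a -> p j = Some a.
  by move=> qp j a ji /qp; rewrite ffunE (negPf ji).
(* If [q0] or [q1] does not mention [i], it is itself a subproduct of [p]; otherwise [i] is their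
   only reversal, and the consensus erases it. *)
case q0i: (q0 i) => [b0|]; last first.
  exists q0 => //; apply/subproductP=> j a qj.
  by apply: (lift _ _ q0p) => //; apply: contra_eq_neq qj => ->; rewrite q0i.
case q1i: (q1 i) => [b1|]; last first.
  exists q1 => //; apply/subproductP=> j a qj.
  by apply: (lift _ _ q1p) => //; apply: contra_eq_neq qj => ->; rewrite q1i.
have := q0p _ _ q0i; rewrite ffunE eqxx => -[b0E].
have := q1p _ _ q1i; rewrite ffunE eqxx => -[b1E].
have revE : reversals q0 q1 = [set i].
  apply/setP=> j; rewrite in_set1; apply/reversalsP/eqP => [[b [q0j q1j]]|->].
    apply/eqP/negPn/negP=> ji; have := lift _ _ q0p _ _ ji q0j.
    by rewrite (lift _ _ q1p _ _ ji q1j) => -[]; case: b {q0j q1j}.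
  by exists false; rewrite q0i q1i -b0E -b1E.
exists (consensus q0 q1).
  by apply: clD; rewrite // /valid_consensus revE cards1.
apply/subproductP=> j a; rewrite ffunE revE in_set1; case: ifP => // /negbT ji.
case q0j: (q0 j) => [b|]; last exact: (lift _ _ q1p).
by move=> [<-]; apply: (lift _ _ q0p).
Qed.

(** Completeness gives a [q] in [Consensus B] that is a subproduct of [p]; by soundness [q] is an
    implicant, so minimality of [p] forces [q = p]. *)
Lemma primes_covered n (f : boolfun n) (B : {set product n}) :
  is_basis f B -> prime_products f \subset Consensus B.
Proof.
move=> [/subsetP BP fB]; apply/subsetP=> p; rewrite inE.
case/andP=> /forallP pf /forallP pmin.
have [|q qB qp] := @consensus_complete n (Consensus B) p (Consensus_closed B).
  move=> x px; have := implyP (pf x) px; rewrite fB.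
  case/exists_inP=> q qB qx; apply/exists_inP; exists q => //.
  exact: (subsetP (sub_Consensus B)).
have /implyP/(_ _)/eqP <- // := pmin q; rewrite qp andbT.
by apply/forallP=> x; apply/implyP=> qx; rewrite fB (eval_Consensus qB).
Qed.

Lemma basis_of_covered n (f : boolfun n) (B B' : {set product n}) :
  is_basis f B -> B' \subset prime_products f -> B \subset Consensus B' ->
  is_basis f B'.
Proof.
move=> [BP fB] B'P BB'; split=> // x; apply/idP/idP.
  rewrite fB => /exists_inP [p pB px].
  by apply: eval_Consensus px; apply: (subsetP BB').
case/exists_inP=> p /(subsetP B'P); rewrite inE => /andP [/forallP pf _].
exact: implyP (pf x).
Qed.

Lemma essentials_sub_basis n (f : boolfun n) (B : {set product n}) :
  is_basis f B -> essentials f \subset B.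
Proof.
move=> fB; apply/subsetP=> p; rewrite inE => /andP [pP]; apply: contraR => pB.
have sub : B \subset prime_products f :\ p by rewrite subsetD1 (proj1 fB).
apply: (subsetP (ConsensusS sub)).
exact: (subsetP (primes_covered fB)).
Qed.

(** * Triples tables and cascades *)

Definition firsts n (T : {set entry n}) : {set product n} :=
  [set first e | e in T].

Definition closed_under n (T : {set entry n}) (C : {set product n}) : Prop :=
  forall e, e \in T -> parents e \subset C -> first e \in C.

(** Keeps all ancestors of a product inside the table and excludes entries that hold outright; every
    stage of the extraction preserves it. *)
Definition supplied n (T : {set entry n}) : Prop :=
  forall e, e \in T -> parents e != set0 /\ parents e \subset firsts T.

(** Passing from [T] to [T'] loses no way of covering a product that is still listed: fewer parents
    make a stronger rule. *)
Definition dominates n (T' T : {set entry n}) : Prop :=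
  forall e, e \in T -> first e \in firsts T' ->
  exists2 e', e' \in T' & first e' = first e /\ parents e' \subset parents e.

Lemma first_firsts n (T : {set entry n}) e : e \in T -> first e \in firsts T.
Proof. exact: imset_f. Qed.

Lemma firstsS n (T T' : {set entry n}) :
  T \subset T' -> firsts T \subset firsts T'.
Proof. exact: imsetS. Qed.

Lemma closed_underS n (T T' : {set entry n}) C :
  T \subset T' -> closed_under T' C -> closed_under T C.
Proof. by move=> /subsetP TT' clC e /TT'; apply: clC. Qed.

Lemma dominates_trans n (T1 T2 T3 : {set entry n}) :
  firsts T3 \subset firsts T2 ->
  dominates T2 T1 -> dominates T3 T2 -> dominates T3 T1.
Proof.
move=> /subsetP sub dom12 dom23 e eT e3.
have [e' e'T [e'E e'P]] := dom12 e eT (sub _ e3).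
rewrite -e'E in e3 *; have [e'' ? [? ?]] := dom23 e' e'T e3.
by exists e'' => //; split=> //; apply: subset_trans e'P.
Qed.

(** The fixed value is already met at its [findex], which is at most [#|T|]; from there on the
    iteration is constant. *)
Lemma stabilize_fix (T : finType) (g : T -> T) (x : T) m :
  g (iter m g x) = iter m g x -> g (stabilize g x) = stabilize g x.
Proof.
move=> fixm; have xm := fconnect_iter g m x.
have le_m : (findex g x (iter m g x) <= #|T|)%N.
  by apply: leq_trans (ltnW (findex_max xm)) (max_card _).
have mE := iter_findex xm.
rewrite /stabilize -(subnK le_m) iterD mE.
by elim: (_ - _)%N => //= k IHk; rewrite !IHk.
Qed.

Lemma parents_zero_entry n (L : {set product n}) (e : entry n) :
  parents (zero_entry L e) = parents e :\: L.
Proof.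
case: e => [[r i] j]; apply/setP=> a; rewrite !inE /=.
have zE k : (zero_index L k == Some a) = (a \notin L) && (k == Some a).
  case: k => [p|] /=; last by rewrite andbF.
  case: ifP => pL.
    by case: (eqVneq (Some p) (Some a)) => [[<-]|]; rewrite ?pL ?andbF.
  by case: (eqVneq (Some p) (Some a)) => [[<-]|]; rewrite ?pL ?andbF.
by rewrite !zE andb_orr.
Qed.

Lemma first_zero_entry n (L : {set product n}) (e : entry n) :
  first (zero_entry L e) = first e.
Proof. by []. Qed.

Lemma zero_entry_id n (L : {set product n}) (e : entry n) :
  [disjoint parents e & L] -> zero_entry L e = e.
Proof.
case: e => [[r i] j] /disjointFr dis; rewrite /zero_entry /=; congr (_, _, _).
  by case: i dis => //= i dis; rewrite dis // inE /= eqxx.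
by case: j dis => //= j dis; rewrite dis // inE /= eqxx orbT.
Qed.

Lemma parents_eq0 n (e : entry n) :
  parents e = set0 -> e = (first e, None, None).
Proof.
case: e => [[r i] j] /setP e0; congr (_, _, _).
  by case: i e0 => // i /(_ i); rewrite !inE eqxx.
by case: j e0 => // j /(_ j); rewrite !inE eqxx orbT.
Qed.

(** A step may rewrite the table while the list stands still, but the rewritten table no longer
    mentions the list, so the next step changes nothing. *)
Lemma cascade_step_fix n (s : {set product n} * {set entry n}) :
  (cascade_step s).1 = s.1 ->
  cascade_step (cascade_step s) = cascade_step s.
Proof.
case: s => [L T]; case s'E: (cascade_step (L, T)) => [L' T'] /= L'L.
rewrite {}L'L in s'E *.
have T'E e : e \in T' -> first e \notin L /\ [disjoint parents e & L].
  case: s'E => _ <- /imsetP [e0]; rewrite inE => /andP [_ e0L] ->; split=> //.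
  by rewrite parents_zero_entry -setI_eq0 setIDAC setDIl setDv setI0.
have stepT' : [set zero_entry L e | e in [set e in T' | first e \notin L]] = T'.
  apply/setP=> e; apply/imsetP/idP => [[e0]|eT'].
    rewrite inE => /andP [e0T' _] ->.
    by rewrite zero_entry_id //; have [] := T'E e0 e0T'.
  have [eL dis] := T'E e eT'.
  by exists e; rewrite ?inE ?eT' ?zero_entry_id.
by rewrite /cascade_step /= stepT'; case: s'E => + E; rewrite E => ->.
Qed.

Lemma cascade_fix n (S : {set product n}) (T : {set entry n}) :
  cascade_step (stabilize (@cascade_step n) (S, T)) =
  stabilize (@cascade_step n) (S, T).
Proof.
pose s m := iter m (@cascade_step n) (S, T).
pose N := #|{: product n}|.
suff /existsP [m /eqP mE] : [exists m : 'I_N.+1, (s m.+1).1 == (s m).1].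
  by apply: (@stabilize_fix _ _ _ m.+1); rewrite -/(s m) /= cascade_step_fix.
apply: contraT => /existsPn noteq.
(* A list growing at each of the first [N.+1] steps would have more than [N] products. *)
have grow m : (m <= N.+1)%N -> (m <= #|(s m).1|)%N.
  elim: m => // m IHm mN; apply: leq_ltn_trans (IHm (ltnW mN)) _.
  apply: proper_card; rewrite properEneq subsetUl andbT eq_sym.
  exact: (noteq (Ordinal mN)).
by have := leq_trans (grow _ (leqnn _)) (max_card _); rewrite ltnn.
Qed.

Lemma stabilize_ind (T : finType) (P : T -> Prop) (g : T -> T) (x : T) :
  P x -> (forall y, P y -> P (g y)) -> P (stabilize g x).
Proof. by move=> Px Pg; rewrite /stabilize; elim: #|T| => //= k /Pg. Qed.

(** * The cascade list as the least closed set containing [S] *)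

Section Cascade.

Variables (n : nat) (S : {set product n}) (T : {set entry n}).

Let L := cascade_list S T.
Let T' := Cascade S T.

Let fixP : L = L :|: [set t | (t, None, None) \in T'] /\
  T' = [set zero_entry L e | e in [set e in T' | first e \notin L]].
Proof.
rewrite /L /T' /cascade_list /Cascade.
case: (stabilize _ _) (cascade_fix S T) => L1 T1 [LE T1E].
by rewrite T1E in LE; rewrite /= LE T1E.
Qed.

(** Read off the fixed point: an entry with first index in [L] would be deleted, a parent in [L]
    zeroed, and an entry without parents would put its first index into [L]. *)
Lemma Cascade_out (e : entry n) : e \in T' ->
  [/\ first e \notin L, parents e != set0 & [disjoint parents e & L]].
Proof.
have [LE T'E] := fixP; move=> eT'; move: (eT'); rewrite T'E.
case/imsetP=> e0; rewrite inE => /andP [_ e0L] eE.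
have eL : first e \notin L by rewrite eE.
split=> //; last first.
  by rewrite eE parents_zero_entry -setI_eq0 setIDAC setDIl setDv setI0.
apply/eqP=> /parents_eq0 e0E; move: eL; rewrite LE !inE negb_or -e0E eT'.
by rewrite andbF.
Qed.

Lemma sub_cascade_list : S \subset L.
Proof.
rewrite /L /cascade_list.
pose P (s : {set product n} * {set entry n}) : Prop := S \subset s.1.
apply: (@stabilize_ind _ P) => [|s Ps]; first exact: subxx.
exact: subset_trans Ps (subsetUl _ _).
Qed.

Lemma Cascade_from (e' : entry n) : e' \in T' ->
  exists2 e, e \in T &
    [/\ first e = first e', parents e' \subset parents e
      & parents e \subset parents e' :|: L].
Proof.
move: e'; rewrite /L /T' /cascade_list /Cascade.
pose P (s : {set product n} * {set entry n}) := forall e', e' \in s.2 ->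
  exists2 e, e \in T & [/\ first e = first e', parents e' \subset parents e
                         & parents e \subset parents e' :|: s.1].
apply: (@stabilize_ind _ P); rewrite /P /=.
  by move=> e eT; exists e => //; split=> //; apply: subsetUl.
case=> L1 T1 /= IH e' /imsetP [e1].
rewrite inE => /andP [/IH [e eT [e1E se es]] e1L] ->.
exists e => //; rewrite parents_zero_entry; split=> //.
  exact: subset_trans (subsetDl _ _) se.
apply: subset_trans es _; apply/subsetP=> a; rewrite !inE.
by case: (a \in L1); rewrite ?orbT ?orbF //= => ->.
Qed.

Lemma Cascade_to (e : entry n) : e \in T ->
  first e \in L \/ exists2 e', e' \in T' &
    first e' = first e /\ parents e' \subset parents e.
Proof.
move: e; rewrite /L /T' /cascade_list /Cascade.
pose P (s : {set product n} * {set entry n}) := forall e, e \in T ->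
  first e \in s.1 \/ exists2 e', e' \in s.2 &
    first e' = first e /\ parents e' \subset parents e.
apply: (@stabilize_ind _ P); rewrite /P /=.
  by move=> e eT; right; exists e.
case=> L1 T1 /= IH e /IH [eL|[e1 e1T [e1E e1P]]]; first by left; rewrite inE eL.
case: (boolP (first e1 \in L1)) => e1L; first by left; rewrite -e1E inE e1L.
right; exists (zero_entry L1 e1); first by apply: imset_f; rewrite inE e1T.
rewrite parents_zero_entry; split=> //.
exact: subset_trans (subsetDl _ _) e1P.
Qed.

(** If the first index were outside [L], the entry would leave a remainder in [T'] whose parents are
    non-empty and disjoint from [L], yet among those of [e]. *)
Lemma cascade_list_closed : closed_under T L.
Proof.
move=> e eT eL; have [//|[e' e'T [_ e'P]]] := Cascade_to eT.
have [_ /set0Pn [a ae'] dis] := Cascade_out e'T.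
by have := disjointFr dis ae'; rewrite (subsetP eL) // (subsetP e'P).
Qed.

Lemma cascade_list_min (C : {set product n}) :
  S \subset C -> closed_under T C -> L \subset C.
Proof.
move=> SC clC; rewrite /L /cascade_list.
pose P (s : {set product n} * {set entry n}) :=
  s.1 \subset C /\ closed_under s.2 C.
suff [] : P (stabilize (@cascade_step n) (S, T)) by [].
apply: stabilize_ind => // -[L1 T1] [/= L1C cl1].
have cl1' : closed_under (cascade_step (L1, T1)).2 C.
  move=> _ /imsetP [e + ->]; rewrite inE => /andP [eT _].
  rewrite parents_zero_entry first_zero_entry => eC; apply: cl1 => //.
  apply/subsetP=> a ae; case: (boolP (a \in L1)) => aL.
    exact: (subsetP L1C).
  by apply: (subsetP eC); rewrite inE aL.
split=> //; rewrite subUset L1C; apply/subsetP=> t; rewrite inE => tT.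
apply: (cl1' _ tT); apply/subsetP=> a; by rewrite inE.
Qed.

Lemma card_Cascade : (#|T'| <= #|T|)%N.
Proof.
rewrite /T' /Cascade.
pose P (s : {set product n} * {set entry n}) : Prop := (#|s.2| <= #|T|)%N.
apply: (@stabilize_ind _ P) => [|s IH]; first exact: leqnn.
apply: leq_trans (leq_imset_card _ _) _.
apply: leq_trans IH; apply: subset_leq_card.
by apply/subsetP=> e; rewrite inE => /andP [].
Qed.

Lemma Cascade_eq0 : T' = set0 <-> firsts T \subset L.
Proof.
split=> [T'0|sub].
  apply/subsetP=> _ /imsetP [e eT ->].
  by have [//|[e']] := Cascade_to eT; rewrite T'0 inE.
apply/setP=> e'; rewrite inE; apply/negP=> e'T.
have [e eT [eE _ _]] := Cascade_from e'T.
have [/negP + _ _] := Cascade_out e'T; apply.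
by rewrite -eE (subsetP sub) // first_firsts.
Qed.

End Cascade.

(** * Reduction of a table *)

(* The last clause: products dropped from the table were unused, hence get
   covered once all others are. *)
Definition trims n (T T' : {set entry n}) : Prop :=
  [/\ supplied T', T' \subset T, dominates T' T
    & forall C, closed_under T C -> firsts T' \subset C -> firsts T \subset C].

Lemma trims_trans n (T1 T2 T3 : {set entry n}) :
  trims T1 T2 -> trims T2 T3 -> trims T1 T3.
Proof.
move=> [_ s12 d12 c12] [sup s23 d23 c23]; split=> //.
- exact: subset_trans s12.
- exact: dominates_trans (firstsS s23) d12 d23.
by move=> C clC sub; apply: c12 => //; apply: c23 => //; apply: closed_underS clC.
Qed.

(** The entry that makes [e] useless has a single parent, so it is not useless itself and stands in
    for [e]. *)
Lemma trims_remove_useless n (T : {set entry n}) :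
  supplied T -> trims T (remove_useless T).
Proof.
move=> supT.
have sub : remove_useless T \subset T by apply/subsetP=> e; rewrite inE => /andP [].
have dom e : e \in T -> exists2 e', e' \in remove_useless T &
    first e' = first e /\ parents e' \subset parents e.
  move=> eT; case: (boolP (e \in remove_useless T)) => [eU|]; first by exists e.
  rewrite inE eT negbK => /andP [_ /exists_inP [e' e'T]].
  case/and3P=> /eqP ee' c1 sub'.
  by exists e' => //; rewrite inE e'T (eqP c1).
have firstsE : firsts T \subset firsts (remove_useless T).
  apply/subsetP=> _ /imsetP [e eT ->]; have [e' e'U [<- _]] := dom e eT.
  exact: first_firsts.
split=> //.
- move=> e /(subsetP sub)/supT [e0 eT]; split=> //.
  exact: subset_trans firstsE.
- by move=> e eT _; apply: dom.
- by move=> C _; apply: subset_trans.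
Qed.

(** Activity depends on the first index alone, so the entries of a product stay or go together.
    Parents are active, so a dropped product is covered as soon as the surviving ones are. *)
Lemma trims_remove_inactive n (T : {set entry n}) :
  supplied T -> trims T (remove_inactive T).
Proof.
move=> supT.
have sub : remove_inactive T \subset T by apply/subsetP=> e; rewrite inE => /andP [].
have parI e : e \in T -> parents e \subset firsts (remove_inactive T).
  move=> eT; apply/subsetP=> a ae; have [_ /subsetP/(_ a ae)] := supT e eT.
  case/imsetP=> e2 e2T aE; rewrite aE; apply: first_firsts; rewrite inE e2T.
  by apply/exists_inP; exists e; rewrite // -aE.
split=> //.
- move=> e /(subsetP sub) eT; split; last exact: parI.
  by have [] := supT e eT.
- move=> e eT /imsetP [e']; rewrite inE => /andP [_ act] eE.
  by exists e => //; rewrite inE eT eE.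
- move=> C clC subC; apply/subsetP=> _ /imsetP [e eT ->]; apply: clC => //.
  exact: subset_trans (parI e eT) subC.
Qed.

Lemma trims_reduce n (T : {set entry n}) : supplied T -> trims T (reduce T).
Proof.
move=> supT; rewrite /reduce; apply: stabilize_ind.
  exact: trims_remove_useless.
move=> T' TT'; apply: (trims_trans TT'); apply: trims_remove_inactive.
by case: TT'.
Qed.

(** * Independent Ancestor Sets *)

Lemma parent_relP n (T : {set entry n}) r i :
  reflect (exists e, [/\ e \in T, first e = r & i \in parents e])
          (parent_rel T r i).
Proof.
apply: (iffP exists_inP) => [[e eT /andP [/eqP ? ?]]|[e [eT <- ie]]].
  by exists e.
by exists e; rewrite // eqxx.
Qed.

Lemma AncP n (T : {set entry n}) r a :
  reflect (exists2 i, parent_rel T r i & connect (parent_rel T) i a)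
          (a \in Anc T r).
Proof.
rewrite inE; apply: (iffP existsP) => [[i /andP []]|[i ? ?]]; exists i => //.
exact/andP.
Qed.

Lemma Anc_parents n (T : {set entry n}) r e :
  e \in T -> first e \in Anc T r -> parents e \subset Anc T r.
Proof.
move=> eT /AncP [i ri ia]; apply/subsetP=> b be; apply/AncP; exists i => //.
apply: connect_trans ia _; apply: connect1; apply/parent_relP.
by exists e.
Qed.

Lemma Anc_sub n (T : {set entry n}) r a :
  a \in Anc T r -> Anc T a \subset Anc T r.
Proof.
case/AncP=> i ri ia; apply/subsetP=> b /AncP [j aj jb]; apply/AncP; exists i => //.
by apply: connect_trans ia _; apply: connect_trans jb; apply: connect1.
Qed.

Lemma Anc_firsts n (T : {set entry n}) r :
  supplied T -> Anc T r \subset firsts T.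
Proof.
move=> supT; apply/subsetP=> a /AncP [i ri].
have {}ri : i \in firsts T.
  case/parent_relP: ri => e [eT _]; have [_] := supT e eT.
  by move/subsetP; apply.
case/connectP=> p + ->; elim: p i ri => //= b p IHp i _ /andP [ib pP].
apply: IHp pP; case/parent_relP: ib => e [eT _]; have [_] := supT e eT.
by move/subsetP; apply.
Qed.

Section Independent.

Variables (n : nat) (T : {set entry n}).
Hypothesis supT : supplied T.

Lemma independent_firsts A : A \in independent_sets T -> A \subset firsts T.
Proof. by rewrite inE => /andP [/imsetP [e eT ->] _]; apply: Anc_firsts. Qed.

Lemma independent_parents A e :
  A \in independent_sets T -> e \in T -> first e \in A -> parents e \subset A.
Proof.
by rewrite inE => /andP [/imsetP [e0 e0T ->] _] eT eA; apply: Anc_parents.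
Qed.

(** As [a] has an entry, [Anc T a] is itself an Ancestor Set; it lies inside [A], and independence
    forbids a proper inclusion. *)
Lemma independent_Anc A a : A \in independent_sets T -> a \in A -> Anc T a = A.
Proof.
move=> AT aA; have /imsetP [e eT aE] := subsetP (independent_firsts AT) a aA.
move: AT; rewrite inE => /andP [/imsetP [e0 e0T AE] /exists_inPn min].
apply/eqP; rewrite eqEsubset AE Anc_sub -?AE //=; apply/negPn/negP=> nsub.
have /negP := min _ (imset_f (fun e => Anc T (first e)) eT); apply.
by rewrite -aE properE nsub andbT AE Anc_sub // -AE.
Qed.

Lemma independent_disjoint A B :
  A \in independent_sets T -> B \in independent_sets T -> A != B ->
  [disjoint A & B].
Proof.
move=> AT BT AB; rewrite -setI_eq0; apply: contraR AB => /set0Pn [a].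
by rewrite inE => /andP [/(independent_Anc AT) <- /(independent_Anc BT) <-].
Qed.

Lemma triples_ofE A : A \in independent_sets T ->
  triples_of T A = [set e in T | first e \in A].
Proof.
move=> AT; apply/setP=> e; rewrite !inE; case: (boolP (e \in T)) => //= eT.
by case: (boolP (first e \in A)) => //= eA; rewrite (independent_parents AT).
Qed.

(** A smallest Ancestor Set is independent. It contains a parent of some entry, and that parent has
    an entry of its own. This makes the extraction terminate. *)
Lemma independent_exists : T != set0 ->
  exists2 A, A \in independent_sets T & triples_of T A != set0.
Proof.
case/set0Pn=> e0 e0T.
have e0P : Anc T (first e0) \in ancestor_sets T by exact: imset_f.
case: (arg_minnP (fun A : {set product n} => #|A|) e0P) => A AT Amin.
have {}AT : A \in ancestor_sets T by [].
have AI : A \in independent_sets T.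
  rewrite inE AT; apply/exists_inPn=> B BT; apply/negP=> /proper_card.
  by rewrite ltnNge Amin.
exists A => //; have /imsetP [e eT AE] := AT.
have [/set0Pn [i ie] _] := supT eT.
have iA : i \in A.
  by rewrite AE; apply/AncP; exists i => //; apply/parent_relP; exists e.
have /imsetP [e1 e1T iE] := subsetP (independent_firsts AI) i iA.
by apply/set0Pn; exists e1; rewrite triples_ofE // inE e1T -iE.
Qed.

End Independent.

(** * Extraction *)

Notation extracted n := ({set product n} * {set entry n})%type.

(** The table of the pair refers to its set only and, by domination, keeps every means that [T0]
    offers for covering products of that set. *)
Record autonomous n (T0 : {set entry n}) (x : extracted n) : Prop :=
  Autonomous {
    autonomous_sub : x.1 \subset firsts T0;
    autonomous_firsts : firsts x.2 = x.1;
    autonomous_parents : forall e, e \in x.2 -> parents e \subset x.1;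
    autonomous_dominates : dominates x.2 T0 }.

(** Compares the current table and the extracted pairs with the original [T0]. Since cascades zero
    parents, [inv_closed] and [inv_order] claim the current rules only for sets [C] that contain
    what was extracted earlier. *)
Record extraction_inv n (T0 : {set entry n})
    (s : {set entry n} * seq (extracted n)) : Prop := ExtractionInv {
  inv_supplied : supplied s.1;
  inv_firsts : firsts s.1 \subset firsts T0;
  inv_dominates : dominates s.1 T0;
  inv_closed : forall C, closed_under T0 C ->
    (forall x, x \in s.2 -> x.1 \subset C) ->
    closed_under s.1 C /\ (firsts s.1 \subset C -> firsts T0 \subset C);
  inv_fresh : forall x, x \in s.2 -> [disjoint firsts s.1 & x.1];
  inv_disjoint : pairwise (fun x y : extracted n => [disjoint x.1 & y.1]) s.2;
  inv_autonomous : forall x, x \in s.2 -> autonomous T0 x;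
  inv_order : forall x0 i, (i < size s.2)%N ->
    forall C, closed_under T0 C ->
    (forall y, y \in take i s.2 -> y.1 \subset C) ->
    closed_under (nth x0 s.2 i).2 C }.

Lemma inv_reduce n (T0 : {set entry n}) T l :
  extraction_inv T0 (T, l) -> extraction_inv T0 (reduce T, l).
Proof.
case=> /= supT subT domT clT freshT disT autT ordT.
have [supR RT domR clR] := trims_reduce supT.
split=> //=.
- exact: subset_trans (firstsS RT) subT.
- exact: dominates_trans (firstsS RT) domT domR.
- move=> C cl0 lC; have [clTC subC] := clT C cl0 lC.
  split; first exact: closed_underS clTC.
  by move=> RC; apply/subC/clR.
- by move=> x xl; have := freshT x xl; apply: disjointWl; apply: firstsS.
Qed.

(** * One round of the extraction *)

Section Round.

Variables (n : nat) (T0 R : {set entry n}) (l : seq (extracted n)).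
Hypothesis invR : extraction_inv T0 (R, l).

Let found := independent_sets R.
Let U := \bigcup_(A in found) A.
Let R' := R :\: \bigcup_(A in found) triples_of R A.
Let L := cascade_list U R'.
Let T' := Cascade U R'.
Let new := [seq (A, triples_of R A) | A <- enum found].

Let supR : supplied R := inv_supplied invR.

Let R'E e : (e \in R') = (e \in R) && (first e \notin U).
Proof.
rewrite inE andbC; case: (boolP (e \in R)) => //= eR; congr (~~ _).
apply/bigcupP/bigcupP => -[A AR eA]; exists A => //; move: eA.
  by rewrite (triples_ofE AR) inE => /andP [].
by rewrite (triples_ofE AR) inE eR.
Qed.

Let R'R : R' \subset R. Proof. exact: subsetDl. Qed.

Let UL : U \subset L. Proof. exact: sub_cascade_list. Qed.

Let T'L r : r \in firsts T' -> r \notin L.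
Proof. by case/imsetP=> e /Cascade_out [eL _ _] ->. Qed.

Let T'R : firsts T' \subset firsts R.
Proof.
apply/subsetP=> _ /imsetP [e /Cascade_from [e0 e0R' [<- _ _]] ->].
by apply: first_firsts; apply: (subsetP R'R).
Qed.

Let R'_firsts r : r \in firsts R -> r \notin L -> r \in firsts T'.
Proof.
case/imsetP=> e eR -> eL; have eU : first e \notin U.
  by apply: contra eL; apply: (subsetP UL).
have eR' : e \in R' by rewrite R'E eR.
have [|[e' e'T [<- _]]] := Cascade_to U eR'; last exact: first_firsts.
by rewrite -/L (negPf eL).
Qed.

Let supT' : supplied T'.
Proof.
move=> e eT; have [eL e0 dis] := Cascade_out eT; split=> //.
have [e0' e0R [_ /subsetP sub _]] := Cascade_from eT.
apply/subsetP=> a ae; apply: R'_firsts; last by rewrite (disjointFr dis ae).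
have [_ /subsetP] := supR (subsetP R'R _ e0R); apply.
exact: sub.
Qed.

Let domT' : dominates T' R.
Proof.
move=> e eR eT'; have eL := T'L eT'.
have eR' : e \in R' by rewrite R'E eR; apply: contra eL; apply: (subsetP UL).
by have [|] := Cascade_to U eR'; first by rewrite -/L (negPf eL).
Qed.

Let newP x : x \in new -> x.1 \in found /\ x.2 = triples_of R x.1.
Proof. by case/mapP=> A; rewrite mem_enum => AR ->. Qed.

Let new_autonomous x : x \in new -> autonomous T0 x.
Proof.
case/newP; case: x => /= A _ AR ->.
have subA := independent_firsts supR AR; split=> //=.
- exact: subset_trans subA (inv_firsts invR).
- apply/setP=> a; apply/imsetP/idP => [[e]|aA].
    by rewrite triples_ofE // inE => /andP [_ eA] ->.
  have /imsetP [e eR aE] := subsetP subA a aA.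
  by exists e => //; rewrite triples_ofE // inE eR -aE.
- by move=> e; rewrite inE => /and3P [].
- move=> e e0; rewrite triples_ofE // => /imsetP [e1].
  rewrite inE => /andP [e1R e1A] eE.
  have [|e' e'R [e'E e'P]] := inv_dominates invR e0.
    by rewrite eE; apply: first_firsts.
  by exists e' => //; rewrite inE e'R e'E eE.
Qed.

Let new_disjoint : pairwise (fun x y : extracted n => [disjoint x.1 & y.1]) new.
Proof.
rewrite pairwise_map.
have : pairwise [rel A B | A != B] (enum found).
  by rewrite -uniq_pairwise enum_uniq.
apply: (@sub_in_pairwise _ (mem found)); last first.
  by apply/allP=> A; rewrite mem_enum.
move=> A B AR BR AB; exact: (independent_disjoint supR AR BR AB).
Qed.

Lemma inv_round : extraction_inv T0 (T', l ++ new).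
Proof.
split=> //=.
- exact: subset_trans T'R (inv_firsts invR).
- exact: dominates_trans T'R (inv_dominates invR) domT'.
- move=> C cl0 lC; have [|clR subR] := inv_closed invR cl0.
    by move=> x xl; apply: lC; rewrite mem_cat xl.
  (* The newly extracted sets lie in [C], hence by minimality so does the cascade list; parents
     zeroed by the cascade may then be restored. *)
  have UC : U \subset C.
    apply/bigcupsP=> A AR; have := lC (A, triples_of R A).
    by apply; rewrite mem_cat map_f ?orbT ?mem_enum.
  have clR' : closed_under R' C by apply: closed_underS clR.
  have LC : L \subset C by apply: cascade_list_min.
  split=> [e eT eC|T'C].
    have [e0 e0R [<- _ sub]] := Cascade_from eT; apply: clR' => //.
    by apply: subset_trans sub _; rewrite subUset eC.
  apply: subR; apply/subsetP=> a aR; case: (boolP (a \in L)) => aL.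
    exact: (subsetP LC).
  by apply: (subsetP T'C); apply: R'_firsts.
- move=> x; rewrite mem_cat => /orP [xl|/newP [xR _]].
    have := inv_fresh invR xl; apply: disjointWl; exact: T'R.
  rewrite disjoint_sym; apply/pred0P=> a /=; apply/negP=> /andP [ax /T'L].
  by rewrite (subsetP UL) //; apply/bigcupP; exists x.1.
- rewrite pairwise_cat (inv_disjoint invR) new_disjoint !andbT.
  apply/allrelP=> x y xl /newP [yR _]; rewrite disjoint_sym.
  have := inv_fresh invR xl; apply: disjointWl.
  exact: (independent_firsts supR yR).
- move=> x; rewrite mem_cat => /orP [xl|]; last exact: new_autonomous.
  exact: (inv_autonomous invR xl).
- move=> x0 i; rewrite size_cat nth_cat take_cat => il C cl0.
  (* At an index beyond [l], the pairs taken include all of [l], which makes the rules of [R] valid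
     for [C]. *)
  case: ifP => [il'|/negbT]; first exact: (inv_order invR).
  rewrite -leqNgt => li lC.
  have [|clR _] := inv_closed invR cl0.
    by move=> x xl; apply: lC; rewrite mem_cat xl.
  have /newP [_ ->] : nth x0 new (i - size l) \in new.
    by apply: mem_nth; rewrite ltn_subLR.
  by apply: closed_underS clR; apply/subsetP=> e; rewrite inE => /andP [].
Qed.

Lemma card_round : R != set0 -> (#|T'| < #|R|)%N.
Proof.
move=> /(independent_exists supR) [A AR /set0Pn [e eA]].
apply: leq_ltn_trans (card_Cascade _ _) _; apply: proper_card.
apply/properP; split=> //; exists e; first by move: eA; rewrite inE => /andP [].
by rewrite inE negb_and negbK; apply/orP; left; apply/bigcupP; exists A.
Qed.

End Round.

Lemma inv_extraction_round n (T0 : {set entry n}) s :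
  extraction_inv T0 s -> extraction_inv T0 (extraction_round s).
Proof. by case: s => T l invs; apply/inv_round/inv_reduce. Qed.

Lemma card_extraction_round n (T0 : {set entry n}) s :
  extraction_inv T0 s -> (#|(extraction_round s).1| <= #|s.1|.-1)%N.
Proof.
case: s => T l /= invT; have invR := inv_reduce invT.
have [_ RT _ _] := trims_reduce (inv_supplied invT).
have le_RT := subset_leq_card RT.
case: (eqVneq (reduce T) set0) => [R0|Rn0].
  by apply: leq_trans (card_Cascade _ _) _; rewrite R0 set0D cards0.
by have := leq_trans (card_round invR Rn0) le_RT; case: #|T|.
Qed.

(** The invariant refers to the unreduced table. A round lowers the size of a non-empty table by at
    least one, so [#|triples f K|] rounds empty it. *)
Lemma inv_extraction n (f : boolfun n) (K : {set product n}) :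
  supplied (raw_triples f K) ->
  extraction_inv (raw_triples f K) (extraction f K) /\ (extraction f K).1 = set0.
Proof.
set T0 := raw_triples f K => supT0.
have inv0 : extraction_inv T0 (T0, [::]).
  by split=> //= e eT _; exists e.
have [+ leN] : extraction_inv T0 (extraction f K) /\
    (#|(extraction f K).1| <= #|triples f K| - #|triples f K|)%N.
  rewrite /extraction; have := inv_reduce inv0; rewrite -/(triples f K).
  set T := triples f K => invT.
  have loop k : extraction_inv T0 (iter k (@extraction_round n) (T, [::])) /\
      (#|(iter k (@extraction_round n) (T, [::])).1| <= #|T| - k)%N.
    elim: k => [|k [IHinv IHk]] /=; first by rewrite subn0.
    split; first exact: inv_extraction_round.
    apply: leq_trans (card_extraction_round IHinv) _.
    by move: IHk; rewrite subnS; case: #|_| => [|c] /=; case: (_ - _)%N.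
  exact: loop.
by split=> //; apply/eqP; rewrite -cards_eq0 -leqn0 -(subnn #|triples f K|).
Qed.

(** * The table of a Boolean function *)

Section RawTriples.

Variables (n : nat) (f : boolfun n) (K : {set product n}).
Hypothesis hK : K \subset nonfree_primes f.

Let P := prime_products f.
Let F := free_products f.
Let NF := nonfree_products f.
Let T0 := raw_triples f K.

Lemma essentials_prime : essentials f \subset P.
Proof. by apply/subsetP=> p; rewrite inE => /andP []. Qed.

Lemma essentials_free : essentials f \subset F.
Proof. exact: sub_Consensus. Qed.

Lemma free_sub : F \subset Consensus P.
Proof. exact: ConsensusS essentials_prime. Qed.

Lemma nonfree_primes_sub : nonfree_primes f \subset NF.
Proof. exact: setSD (sub_Consensus P). Qed.

(** Free factors become the index 0, so the recorded parents are exactly the non-free factors; two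
    free factors cannot occur, as their consensus would be free. *)
Lemma raw_consensus (p q : product n) :
  p \in Consensus P -> q \in Consensus P -> valid_consensus p q ->
  consensus p q \notin F ->
  exists e, [/\ e \in T0, first e = consensus p q & parents e = [set p; q] :\: F].
Proof.
move=> pP qP pq rF.
have rNF : consensus p q \in NF.
  by rewrite inE rF; have /consensus_closedP := Consensus_closed P; apply.
have one (a b : product n) : a \in NF -> b \in F -> valid_consensus a b ->
    consensus a b \in NF -> exists e, [/\ e \in T0, first e = consensus a b
      & parents e = [set a; b] :\: F].
  move=> aNF bF ab abNF; exists (consensus a b, Some a, None); split=> //.
    rewrite inE abNF /= aNF /=; apply/orP; left.
    by apply/exists_inP; exists b; rewrite ?ab ?eqxx.
  apply/setP=> c; rewrite !inE /= orbF.
  have aF : a \notin F by move: aNF; rewrite inE => /andP [].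
  rewrite (inj_eq Some_inj) eq_sym; case: eqVneq => [->|_] /=; first by rewrite aF.
  by case: eqVneq => [->|_]; rewrite ?bF ?andbF.
case: (boolP (p \in F)) => pF; case: (boolP (q \in F)) => qF.
- have /consensus_closedP/(_ p q pF qF pq) := Consensus_closed (essentials f).
  by rewrite -/(free_products f) -/F (negPf rF).
- have [|//|||e [eT eE eP]] := one q p; rewrite 1?valid_consensusC 1?consensusC //.
    by rewrite inE qF.
  by exists e; split=> //; rewrite setUC.
- by apply: one => //; rewrite inE pF.
have pNF : p \in NF by rewrite inE pF.
have qNF : q \in NF by rewrite inE qF.
exists (consensus p q, Some p, Some q); split=> //.
  by rewrite inE rNF /= pNF qNF pq eqxx.
apply/setP=> c; rewrite !inE /=.
rewrite !(inj_eq Some_inj) ![_ == c]eq_sym.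
case: eqVneq => [->|_] /=; rewrite ?pF //.
by case: eqVneq => [->|_]; rewrite ?qF ?andbF.
Qed.

Lemma raw_nonfree e : e \in T0 -> first e \in NF.
Proof. by rewrite inE => /andP []. Qed.

Lemma raw_parents e : e \in T0 -> parents e != set0 /\ parents e \subset NF.
Proof.
case: e => [[r [i|]] [j|]]; rewrite inE /= ?andbF // => /andP [_].
  case/and4P=> iNF jNF _ _; split.
    by apply/set0Pn; exists i; rewrite inE eqxx.
  by apply/subsetP=> a; rewrite inE => /orP [] /eqP [<-].
move=> iP; have iNF : i \in NF.
  case/orP: iP => [/andP []|/and3P [iK _ _]] //.
  by apply/(subsetP nonfree_primes_sub)/(subsetP hK).
split; first by apply/set0Pn; exists i; rewrite inE eqxx.
by apply/subsetP=> a; rewrite inE orbF => /eqP [<-].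
Qed.

(* A non-free prime is not essential, hence is covered by the other primes. *)
Lemma raw_firsts : firsts T0 = NF.
Proof.
apply/eqP; rewrite eqEsubset; apply/andP; split.
  by apply/subsetP=> _ /imsetP [e eT ->]; apply: raw_nonfree.
(* A covered product outside [S] arises by a consensus, hence is a first index. A non-prime [r]
   takes [P] for [S], a prime one [P :\ r]. *)
have key (S : {set product n}) r :
    S \subset P -> r \notin S -> r \in Consensus S -> r \in NF ->
    r \in firsts T0.
  move=> SP rS rC; rewrite inE => /andP [rF _].
  have [|[p [q [pS qS pq rE]]]] := ConsensusP rC; first by rewrite (negPf rS).
  have sub := subsetP (ConsensusS SP).
  have [||||e [eT eE _]] := @raw_consensus p q; rewrite -?rE ?sub //.
  by rewrite rE -eE first_firsts.
apply/subsetP=> r rNF; have := rNF; rewrite inE => /andP [rF rC].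
case: (boolP (r \in P)) => rP; last exact: key rNF.
apply: (key (P :\ r)) rNF; rewrite ?subsetDl ?setD11 //.
apply: contraR rF => rN; apply: (subsetP essentials_free).
by rewrite inE rP.
Qed.

Lemma raw_supplied : supplied T0.
Proof. by move=> e /raw_parents; rewrite raw_firsts. Qed.

(** Each kind of entry records a genuine covering: [C] contains [F], the closure of the essential
    primes, and with any [i] also the closure of [i |: F]. *)
Lemma raw_sound (C : {set product n}) :
  essentials f \subset C -> consensus_closed C -> closed_under T0 C.
Proof.
move=> EC clC; have FC : F \subset C by apply: Consensus_min.
have /consensus_closedP clC' := clC.
case=> [[r [i|]] [j|]]; rewrite inE /first /= ?andbF // => /andP [_] + /subsetP sub.
  case/and4P=> _ _ ij /eqP ->; apply: clC' => //; apply: sub; rewrite inE /=.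
    by rewrite eqxx.
  by rewrite eqxx orbT.
have iC : i \in C by apply: sub; rewrite inE eqxx.
case/orP=> [/andP [_ /exists_inP [p pF /andP [ip /eqP ->]]]|/and3P [_ _]].
  by apply: clC' => //; apply: (subsetP FC).
by apply/subsetP; apply: Consensus_min => //; rewrite subUset sub1set iC.
Qed.

(** Conversely, the free products and the rules of the table reproduce every consensus, since some
    entry has just the non-free factors as parents. *)
Lemma raw_complete (C : {set product n}) :
  closed_under T0 C -> consensus_closed (F :|: (C :&: NF)).
Proof.
move=> clC; apply/consensus_closedP=> p q pD qD pq.
have DP : F :|: (C :&: NF) \subset Consensus P.
  by rewrite subUset free_sub subIset // subsetDl orbT.
case: (boolP (consensus p q \in F)) => rF; first by rewrite inE rF.
have [||e [eT eE eP]] := raw_consensus _ _ pq rF; try exact: (subsetP DP).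
apply/setUP; right; apply/setIP; rewrite -eE; split; last exact: raw_nonfree.
apply: clC => //; rewrite eP; apply/subsetP=> a /setDP [apq aF].
have aD : a \in F :|: (C :&: NF) by case/set2P: apq => ->.
by case/setUP: aD => [|/setIP [] //]; rewrite (negPf aF).
Qed.

End RawTriples.

(** * Bases and covers *)

Lemma cost_setID (R : realFieldType) n (c : product n -> R)
    (X Y : {set product n}) : cost c X = cost c (X :&: Y) + cost c (X :\: Y).
Proof. exact: big_setID. Qed.

Lemma cost_ge0 (R : realFieldType) n (c : product n -> R)
    (X : {set product n}) :
  (forall p, 0 < c p) -> 0 <= cost c X.
Proof. by move=> c0; apply: sumr_ge0 => p _; apply: ltW. Qed.

Lemma cost_sub (R : realFieldType) n (c : product n -> R)
    (X Y : {set product n}) :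
  (forall p, 0 < c p) -> X \subset Y -> cost c X <= cost c Y.
Proof.
by move=> c0 /setIidPr XY; rewrite (cost_setID c Y X) XY lerDl cost_ge0.
Qed.

Lemma cost_min_eq (R : realFieldType) n (c : product n -> R)
    (X Y : {set product n}) :
  (forall p, 0 < c p) -> X \subset Y -> cost c Y <= cost c X -> Y = X.
Proof.
move=> c0 XY le_YX; apply/eqP; rewrite eqEsubset XY andbT.
apply/subsetP=> p pY; apply: contraLR le_YX => pX; rewrite -ltNge.
rewrite (cost_setID c Y X) (setIidPr XY) ltrDl.
apply: lt_le_trans (c0 p) _; rewrite /cost (bigD1 p) ?inE ?pX //= lerDl.
by apply: sumr_ge0 => q _; apply: ltW.
Qed.

(** * The extracted sets, their covers and the bases of [f] *)

Section Decomposition.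

Variables (n : nat) (f : boolfun n) (K : {set product n}).
Hypothesis hK : K \subset nonfree_primes f.

Let P := prime_products f.
Let F := free_products f.
Let NF := nonfree_products f.
Let T0 := raw_triples f K.
Let N := size (IAS f K).
Let A (i : 'I_N) : {set product n} := (tnth (in_tuple (IAS f K)) i).1.
Let TS (i : 'I_N) : {set entry n} := (tnth (in_tuple (IAS f K)) i).2.
Let PS (i : 'I_N) : {set product n} := primeset f (A i).

Let inv : extraction_inv T0 (extraction f K).
Proof. by case: (inv_extraction (raw_supplied hK)). Qed.

Lemma extraction_done : (extraction f K).1 = set0.
Proof. by case: (inv_extraction (raw_supplied hK)). Qed.

Let autA i : autonomous T0 (A i, TS i).
Proof.
rewrite /A /TS -surjective_pairing; apply: (inv_autonomous inv).
exact: (mem_tnth i (in_tuple (IAS f K))).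
Qed.

Lemma IAS_nonfree i : A i \subset NF.
Proof. by have := autonomous_sub (autA i); rewrite raw_firsts. Qed.

Lemma IAS_disjoint i j : i != j -> [disjoint A i & A j].
Proof.
pose x0 := tnth (in_tuple (IAS f K)) i.
have lt_dis (k l : 'I_N) : (k < l)%N -> [disjoint A k & A l].
  move=> kl; rewrite /A !(tnth_nth x0) /=.
  by have /(pairwiseP x0) := inv_disjoint inv; apply; rewrite ?inE.
by case: (ltngtP i j) => [ij _|ji _|/val_inj ->]; 
  [exact: lt_dis | rewrite disjoint_sym; exact: lt_dis | rewrite eqxx].
Qed.

Lemma IAS_sound (i : 'I_N) (C : {set product n}) : closed_under T0 C ->
  (forall k : 'I_N, (k < i)%N -> A k \subset C) -> closed_under (TS i) C.
Proof.
move=> clC ltC; pose x0 := tnth (in_tuple (IAS f K)) i.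
rewrite /TS (tnth_nth x0) /=; apply: (inv_order inv) => // y /(nthP x0) [j].
rewrite size_take -/(IAS f K) ltn_ord => ji <-; rewrite nth_take //.
have jN : (j < N)%N by apply: ltn_trans (ltn_ord i).
by have := ltC (Ordinal jN) ji; rewrite /A (tnth_nth x0).
Qed.

(** The final table is empty, so [inv_closed] applies with nothing left to cover; products dropped
    as inactive are recovered this way. *)
Lemma IAS_cover_nonfree C : closed_under T0 C ->
  (forall i, A i \subset C) -> NF \subset C.
Proof.
move=> clC AC; rewrite /NF -(@raw_firsts _ _ K).
have [|_ ] := inv_closed inv clC; last first.
  by apply; rewrite extraction_done /firsts imset0 sub0set.
move=> x xl; have /tnthP [i ->] : x \in in_tuple (IAS f K) by [].
exact: AC.
Qed.

(* Whatever is known outside A i does not help to cover products of A i. *)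
Lemma IAS_local i (S : {set product n}) :
  closed_under T0 (~: A i :|: cascade_list S (TS i)).
Proof.
move=> e eT /subsetP eC; rewrite !inE; case: (boolP (first e \in A i)) => //= eA.
have [|e' e'T [e'E /subsetP e'P]] := autonomous_dominates (autA i) eT.
  by rewrite (autonomous_firsts (autA i)).
rewrite -e'E; apply: cascade_list_closed => //; apply/subsetP=> a ae'.
have /subsetP/(_ a ae') /= aA := autonomous_parents (autA i) e'T.
by have := eC a (e'P a ae'); rewrite !inE aA.
Qed.

(** By [IAS_local] and [raw_complete], the free products and the non-free ones outside [A i] or in
    the cascade list form a consensus-closed set, which contains [X]. *)
Lemma Consensus_local i (S X : {set product n}) :
  X \subset F :|: NF -> X :&: A i \subset cascade_list S (TS i) ->
  Consensus X :&: A i \subset cascade_list S (TS i).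
Proof.
move=> /subsetP XFN /subsetP XA.
have /subsetP sub : Consensus X \subset
    F :|: ((~: A i :|: cascade_list S (TS i)) :&: NF).
  apply: Consensus_min; last exact: (raw_complete (@IAS_local i S)).
  apply/subsetP=> x xX; have /setUP [xF|xNF] := XFN x xX.
    by apply/setUP; left.
  apply/setUP; right; apply/setIP; split=> //; rewrite in_setU in_setC -implybE.
  by apply/implyP=> xA; apply: XA; apply/setIP.
apply/subsetP=> x /setIP [/sub /setUP [xF|/setIP [/setUP [xA'|//] _]] xA].
  by have := subsetP (IAS_nonfree i) x xA; rewrite inE xF.
by rewrite in_setC xA in xA'.
Qed.

(** Left to right, the earlier sets make the entries of [TS i] sound although cascades removed
    parents from them. Right to left, neither they nor the essential primes meet [A i], so locality
    leaves only [S]. *)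
Lemma IAS_covering (i : 'I_N) (S : {set product n}) (r : product n) :
  S \subset A i -> r \in A i ->
  (r \in cascade_list S (TS i)) =
  (r \in Consensus (essentials f :|: (\bigcup_(k : 'I_N | (k < i)%N) A k) :|: S)).
Proof.
move=> SA rA; set X := _ :|: S; apply/idP/idP => rC.
  apply: (subsetP _ r rC); apply: cascade_list_min.
    by apply: subset_trans (sub_Consensus X); apply: subsetUr.
  apply: IAS_sound.
    apply: raw_sound; last exact: Consensus_closed.
    apply: subset_trans (sub_Consensus X).
    by rewrite /X -setUA subsetUl.
  move=> k ki; apply: subset_trans (sub_Consensus X); rewrite /X.
  by apply: subset_trans (subsetUl _ _); rewrite subsetU // bigcup_sup ?orbT.
have XFN : X \subset F :|: NF.
  rewrite /X !subUset; apply/andP; split; last first.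
    by apply: subset_trans SA _; rewrite subsetU // IAS_nonfree orbT.
  rewrite subsetU ?essentials_free //=; apply/bigcupsP=> k _.
  by rewrite subsetU // IAS_nonfree orbT.
apply: (subsetP (Consensus_local XFN _)); last by apply/setIP.
apply/subsetP=> x /setIP [/setUP [/setUP [xE|/bigcupP [k ki xk]]|xS] xA].
- have := subsetP (IAS_nonfree i) x xA; rewrite inE.
  by rewrite (subsetP (@essentials_free _ f)).
- have ki' : k != i by apply: contraTneq ki => ->; rewrite ltnn.
  by have := disjointFr (IAS_disjoint ki') xk; rewrite xA.
exact: (subsetP (sub_cascade_list S (TS i))).
Qed.

Lemma is_coverP i (Q : {set product n}) :
  is_cover (PS i) (TS i) Q <-> Q \subset PS i /\ A i \subset cascade_list Q (TS i).
Proof.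
have E : firsts (TS i) = A i := autonomous_firsts (autA i).
by rewrite /is_cover -E; split=> -[-> /Cascade_eq0].
Qed.

Lemma prime_free_or_nonfree : P \subset F :|: NF.
Proof.
apply: subset_trans (sub_Consensus P) _; apply/subsetP=> p pP.
by rewrite !inE pP andbT orbN.
Qed.

(** The closure of [B] contains [A i], and by locality only the members of [B] lying in [A i]
    contribute there. *)
Lemma basis_cover (B : {set product n}) i :
  is_basis f B -> is_cover (PS i) (TS i) (B :&: PS i).
Proof.
move=> fB; apply/is_coverP; split; first exact: subsetIr.
have BFN : B \subset F :|: NF.
  exact: subset_trans (proj1 fB) prime_free_or_nonfree.
apply: subset_trans (Consensus_local BFN _).
  rewrite subsetI subxx andbT; apply: subset_trans (IAS_nonfree i) _.
  apply: subset_trans (subsetDl _ _) _; apply: Consensus_sub.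
  exact: primes_covered.
apply: subset_trans (sub_cascade_list _ _).
apply/subsetP=> x /setIP [xB xA]; rewrite !in_setI xB xA.
exact: (subsetP (proj1 fB)).
Qed.

(** The union covers each [A i], then all non-free products, hence all primes and in particular
    those of [B]. *)
Lemma cover_basis (B : {set product n}) (Q : 'I_N -> {set product n}) :
  is_basis f B -> (forall i, is_cover (PS i) (TS i) (Q i)) ->
  is_basis f (essentials f :|: \bigcup_i Q i).
Proof.
move=> fB Qcover; set B' := _ :|: _.
have EB' : essentials f \subset Consensus B'.
  by apply: subset_trans (sub_Consensus _); apply: subsetUl.
have clB' : closed_under T0 (Consensus B').
  by apply: raw_sound => //; apply: Consensus_closed.
have AB' i : A i \subset Consensus B'.
  (* Strong induction in the order of extraction: the entries of [TS i] hold for [Consensus B'] once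
     the sets before [A i] lie in it. *)
  have [m] := ubnP (val i); elim: m i => // m IHm i; rewrite ltnS => im.
  have /is_coverP [_ AL] := Qcover i; apply: subset_trans AL _.
  apply: cascade_list_min.
    apply: subset_trans (sub_Consensus _); rewrite /B'.
    by rewrite subsetU // bigcup_sup ?orbT.
  by apply: IAS_sound => // k ki; apply: IHm; apply: leq_trans im.
apply: (basis_of_covered fB).
  rewrite subUset essentials_prime; apply/bigcupsP=> i _.
  by have [QPS _] := Qcover i; apply: subset_trans QPS _; apply: subsetIr.
apply: subset_trans (proj1 fB) _; apply: subset_trans prime_free_or_nonfree _.
by rewrite subUset Consensus_sub //= IAS_cover_nonfree.
Qed.

(** * Minimum-cost bases *)

Section MinCost.

Variables (R : realFieldType) (c : product n -> R) (B : {set product n}).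
Hypotheses (c_gt0 : forall p, 0 < c p) (minB : min_cost_basis c f B).

(** The trimmed set is still a basis, and omitting any product of [B] would lower the cost. *)
Lemma min_cost_basisE : B = essentials f :|: \bigcup_i (B :&: PS i).
Proof.
have [fB leB] := minB; apply: (cost_min_eq c_gt0).
  rewrite subUset essentials_sub_basis //=.
  by apply/bigcupsP=> i _; apply: subsetIl.
apply: leB; apply: (cover_basis (fB)) => i; exact: (basis_cover i fB).
Qed.

(** Exchange: replacing [B :&: PS i] by [Q] gives another basis, whose cost outside [PS i] does not
    exceed that of [B]. *)
Lemma min_cost_basis_cover i : min_cost_cover c (PS i) (TS i) (B :&: PS i).
Proof.
have [fB leB] := minB; split=> [|Q Qcover]; first exact: basis_cover.
pose Q' k := if k == i then Q else B :&: PS k.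
have fB' : is_basis f (essentials f :|: \bigcup_k Q' k).
  apply: (cover_basis fB) => k; rewrite /Q'.
  by case: eqP => [->//|_]; apply: basis_cover.
have := leB _ fB'; set B' := essentials f :|: _.
(* The other pieces avoid [PS i] because the [A k] are disjoint, the essential primes because they
   are free. *)
have B'Q : B' :&: PS i \subset Q.
  apply/subsetP=> p /setIP [/setUP [pE|/bigcupP [k _ pk]] pPS].
    have /setIP [/(subsetP (IAS_nonfree i)) + _] := pPS.
    by rewrite inE (subsetP (@essentials_free _ f)).
  move: pk; rewrite /Q'; case: (eqVneq k i) => // ki /setIP [_ /setIP [pk _]].
  have /setIP [pi _] := pPS.
  by have := disjointFr (IAS_disjoint ki) pk; rewrite pi.
have B'B : B' :\: PS i \subset B :\: PS i.
  apply/subsetP=> p /setDP [/setUP pB' pPS]; apply/setDP; split=> //.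
  case: pB' => [|/bigcupP [k _]]; first exact/subsetP/essentials_sub_basis.
  rewrite /Q'; case: (eqVneq k i) => [_ pQ|_ /setIP [] //].
  by have [/subsetP/(_ p pQ)] := Qcover; rewrite (negPf pPS).
rewrite (cost_setID c B (PS i)) (cost_setID c B' (PS i)) => le_BB'.
rewrite -(lerD2r (cost c (B :\: PS i))); apply: le_trans le_BB' _.
by apply: lerD; apply: cost_sub.
Qed.

End MinCost.

End Decomposition.

Theorem theorem5p3 (n : nat) (f : boolfun n) (K : {set product n})
    (hK : K \subset nonfree_primes f) :
  let N := size (IAS f K) in
  let A (i : 'I_N) : {set product n} := (tnth (in_tuple (IAS f K)) i).1 in
  let TS (i : 'I_N) : {set entry n} := (tnth (in_tuple (IAS f K)) i).2 in
  let PS (i : 'I_N) : {set product n} := primeset f (A i) in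
  let Surplus : {set product n} := nonfree_primes f :\: \bigcup_i PS i in
  let Unnecessary : {set product n} :=
    ((prime_products f :&: free_products f) :\: essentials f) :|: Surplus in
  (* the extraction of the A_i does run until the table is empty *)
  (extraction f K).1 = set0 /\
  (* partition of the primes *)
  [/\ prime_products f = essentials f :|: (\bigcup_i PS i) :|: Unnecessary,
      forall i, [disjoint essentials f & PS i],
      [disjoint essentials f & Unnecessary],
      forall i, [disjoint PS i & Unnecessary]
    & forall i j, i != j -> [disjoint PS i & PS j]] /\
  (* (1) *)
  (forall B, is_basis f B -> essentials f \subset B) /\
  (* (2) holds by definition of PS; (3) *)
  (forall i j, i != j -> [disjoint A i & A j]) /\
  (* (4) *)
  (forall (R : realFieldType) (c : product n -> R), (forall p, 0 < c p) ->
     forall B, min_cost_basis c f B ->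
     forall p, p \in Unnecessary -> p \notin B) /\
  (* (5) TS i yields exactly the coverings among products of A i, given the
     free products and the sets A k extracted before A i *)
  (forall i (S : {set product n}) (r : product n),
     S \subset A i -> r \in A i ->
     (r \in cascade_list S (TS i)) =
     (r \in Consensus (essentials f :|: (\bigcup_(k : 'I_N | (k < i)%N) A k) :|: S))) /\
  (* (6) *)
  (forall (R : realFieldType) (c : product n -> R), (forall p, 0 < c p) ->
     forall B, min_cost_basis c f B ->
     exists QS : 'I_N -> {set product n},
       B = essentials f :|: \bigcup_i QS i /\
       forall i, min_cost_cover c (PS i) (TS i) (QS i)).
Proof.
move=> N A TS PS Surplus Unnecessary.
have disA := IAS_disjoint hK.
have PS_nonfree i : PS i \subset nonfree_primes f.
  apply/subsetP=> p /setIP [/(subsetP (IAS_nonfree hK i)) /setDP [_ pF] pP].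
  exact/setDP.
have disE i : [disjoint essentials f & PS i].
  apply/pred0P=> p /=; apply/negP=> /andP [/(subsetP (@essentials_free _ f)) pF].
  by move/(subsetP (PS_nonfree i)) => /setDP [_]; rewrite pF.
have disEU : [disjoint essentials f & Unnecessary].
  apply/pred0P=> p /=; apply/negP=> /andP [pE /setUP [/setDP [_]|]].
    by rewrite pE.
  case/setDP=> /setDP [_]; by rewrite (subsetP (@essentials_free _ f)).
have disPU i : [disjoint PS i & Unnecessary].
  apply/pred0P=> p /=; apply/negP=> /andP [pPS /setUP [|/setDP [_ /negP]]].
    have /setDP [_ /negP pF] := subsetP (PS_nonfree i) p pPS.
    by case/setDP=> /setIP [].
  by apply; apply/bigcupP; exists i.
split; first exact: extraction_done.
split; [split=> // | split; first by move=> B; apply: essentials_sub_basis].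
- apply/setP=> p; apply/idP/idP => [pP|].
    rewrite /Unnecessary /Surplus /nonfree_primes !(in_setU, in_setD, in_setI) pP.
    by case: (p \in essentials f); case: (p \in free_products f);
      case: (p \in \bigcup_i PS i).
  case/setUP=> [/setUP [/(subsetP (@essentials_prime _ f))|/bigcupP [i _ /setIP []]]|] //.
  by case/setUP=> [/setDP [/setIP []]|/setDP [/setDP []]].
- by move=> i j ij; apply: disjointW (disA i j ij); apply: subsetIl.
split; first by move=> i j; apply: disA.
split.
  (* A minimum-cost basis consists of the essential primes and its parts in the [PS i], all disjoint
     from [Unnecessary]. *)
  move=> R c c0 B minB p pU; apply/negP.
  rewrite (min_cost_basisE hK c0 minB) => /setUP [pE|/bigcupP [i _ /setIP [_ pPS]]].
    by have := disjointFr disEU pE; rewrite pU.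
  by have := disjointFr (disPU i) pPS; rewrite pU.
split; first by move=> i S r; apply: IAS_covering.
move=> R c c0 B minB; exists (fun i => B :&: PS i); split.
  exact: (min_cost_basisE hK c0 minB).
by move=> i; apply: min_cost_basis_cover.
Qed.
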